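(* Let $R$ be a symmetric Poisson-CGL extension of length $N$. For $\tau\in\Xi_N$ let $y_{\tau,1},\dots,y_{\tau,N}$ be the sequence of homogeneous Poisson-prime elements associated to the P-CGL presentation of $R$ with generators adjoined in the order $x_{\tau(1)},\dots,x_{\tau(N)}$, let $s_\tau$ be the corresponding successor function, and let $\mathcal A_\tau$ be the $\mathbb K$-subalgebra of $R$ generated by $\{y_{\tau,k}\mid k\in[1,N]\}$, $\mathcal T_\tau$ the $\mathbb K$-subalgebra of $\mathrm{Fract}(R)$ generated by $\{y_{\tau,k}^{\pm1}\mid k\in[1,N]\}$, and $E_\tau$ the multiplicative subset of $\mathcal A_\tau$ generated by $\mathbb K^*\sqcup\{y_{\tau,k}\mid k\in[1,N],\ s_\tau(k)\neq+\infty\}$. Then: (a) $\mathcal A_\tau\subseteq R\subseteq\mathcal A_\tau[E_\tau^{-1}]\subseteq\mathcal T_\tau\subseteq\mathrm{Fract}(R)$ for all $\tau\in\Xi_N$. (b) $R$ is generated as a $\mathbb K$-algebra by $\{y_{\tau,k}\mid\tau\in\Gamma_N,\ k\in[1,N]\}$. (c) $R[E_\tau^{-1}]=\mathcal A_\tau[E_\tau^{-1}]$ for all $\tau\in\Xi_N$. (d) $R=\bigcap_{\tau\in\Gamma_N}R[E_\tau^{-1}]=\bigcap_{\tau\in\Gamma_N}\mathcal A_\tau[E_\tau^{-1}]$. (e) Let $\mathbf{inv}$ be any subset of $\{k\in[1,N]\mid s(k)=+\infty\}$. Then $$R[y_k^{-1}\mid k\in\mathbf{inv}]=\bigcap_{\tau\in\Gamma_N}R[E_\tau^{-1}][y_k^{-1}\mid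 k\in\mathbf{inv}].$$
   Context: $\mathbb K$ is a field of characteristic $0$; algebras are $\mathbb K$-algebras, derivations are $\mathbb K$-linear; $[j,k]=\{j,\dots,k\}$. A Poisson algebra is a commutative algebra with a Lie bracket $\{-,-\}$ that is a derivation in each variable. A Poisson action is an action by algebra automorphisms preserving the bracket. A Poisson derivation $\sigma$ of $B$ is a derivation for both product and bracket; a Poisson $\sigma$-derivation is a derivation $\delta$ for the product with $\delta(\{a,b\})=\{\delta(a),b\}+\{a,\delta(b)\}+\sigma(a)\delta(b)-\delta(a)\sigma(b)$. The Poisson-Ore extension $B[x;\sigma,\delta]_p$ is $B[x]$ with the unique Poisson bracket extending that of $B$ with $\{x,b\}=\sigma(b)x+\delta(b)$. For a rational action of a torus $\mathcal H\cong(\mathbb K^* )^r$, homogeneous elements are the $\mathcal H$-eigenvectors and $0$; $\mathrm{Lie}\,\mathcal H\cong\mathbb K^r$ acts by the differential: if $a$ is an $\mathcal H$-eigenvector with eigenvalue $h\mapsto h_1^{u_1}\cdots h_r^{u_r}$, then $\xi\cdot a=(u_1\xi_1+\dots+u_r\xi_r)a$. A Poisson-prime element of a Poisson domain $A$ is a nonzero $c$ with $\{c,A\}\subseteq Ac$ and $A/(c)$ a domain. A Poisson-CGL (P-CGL) extension of length $N$ is an iterated Poisson-Ore extension $R=\mathbb K[x_1]_p[x_2;\sigma_2,\delta_2]_p\cdots[x_N;\sigma_N,\delta_N]_p$ ($\sigma_1=\delta_1=0$; $R_k:=\mathbb K[x_1,\dots,x_k]$, $R_0=\mathbb K$) with a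 rational Poisson action of a torus $\mathcal H$ such that (i) each $x_k$ is an $\mathcal H$-eigenvector; (ii) for $k\in[2,N]$, $\delta_k$ is a locally nilpotent Poisson $\sigma_k$-derivation of $R_{k-1}$; (iii) for $k\in[1,N]$ there is $h_k\in\mathrm{Lie}\,\mathcal H$ with $\sigma_k=(h_k\cdot)|_{R_{k-1}}$ and $h_k\cdot x_k=\lambda_kx_k$, $\lambda_k\neq0$. Write $\sigma_k(x_j)=\lambda_{kj}x_j$ for $j<k$. For $\eta:[1,N]\to\mathbb Z$: $p(k)=\max\{j<k\mid\eta(j)=\eta(k)\}$, $s(k)=\min\{j>k\mid\eta(j)=\eta(k)\}$ ($\max\varnothing=-\infty$, $\min\varnothing=+\infty$). For every P-CGL extension there exist $\eta$ and homogeneous $c_k\in R_{k-1}$ (for $p(k)\neq-\infty$) such that the elements $y_k:=y_{p(k)}x_k-c_k$ if $p(k)\ne-\infty$, $y_k:=x_k$ if $p(k)=-\infty$, are homogeneous and for every $k$ the set $\{y_j\mid j\in[1,k],\,s(j)>k\}$ is a list of the homogeneous Poisson-prime elements of $R_k$ up to scalar multiples; the $y_k$, the level sets of $\eta$, and $p,s$ are uniquely determined by the presentation. In (e), $y_k$ and $s$ refer to the original presentation ($\tau=\mathrm{id}$). For the presentation corresponding to $\tau$ the $\eta$-function can be taken to be $\eta\tau$, and $s_\tau$ is the successor function for its level sets. Put $R_{[j,k]}=\mathbb K[x_i\mid j\le i\le k]$ ($=\mathbb K$ if $j>k$). $R$ is symmetric if (i) $\delta_k(x_j)\in R_{[j+1,k-1]}$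 for all $j<k$; (ii) for every $j\in[1,N]$ there is $h_j^*\in\mathrm{Lie}\,\mathcal H$ with $h_j^*\cdot x_k=-\lambda_{kj}x_k$ for $k\in[j+1,N]$ and $h_j^*\cdot x_j=\lambda_j^*x_j$ with $\lambda_j^*\ne0$. Put $\sigma_j^*=(h_j^*\cdot)$, $\delta_j^*(a)=\{x_j,a\}-\sigma_j^*(a)x_j$. $\Xi_N$ is the set of $\tau\in S_N$ such that $\tau([1,k])$ is an interval for all $k\in[2,N]$. For $\tau\in\Xi_N$, $R=\mathbb K[x_{\tau(1)}]_p[x_{\tau(2)};\sigma''_{\tau(2)},\delta''_{\tau(2)}]_p\cdots[x_{\tau(N)};\sigma''_{\tau(N)},\delta''_{\tau(N)}]_p$ is a P-CGL extension for the same $\mathcal H$, where $(\sigma''_{\tau(k)},\delta''_{\tau(k)})=(\sigma_{\tau(k)},\delta_{\tau(k)})$ if $\tau(k)=\max\tau([1,k-1])+1$ and $(\sigma^*_{\tau(k)},\delta^*_{\tau(k)})$ if $\tau(k)=\min\tau([1,k-1])-1$. $\Gamma_N\subseteq\Xi_N$ is the set of permutations (one-line notation) $\tau_{i,j}=[i+1,\dots,j,i,j+1,\dots,N,i-1,i-2,\dots,1]$, $1\le i\le j\le N$. *)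

(* Defs.v *)
From HB Require Import structures.
From mathcomp Require Import all_boot all_order all_fingroup all_algebra.
From mathcomp Require Import boolp classical_sets.
From mathcomp Require Import fraction mpoly.

Set Implicit Arguments.
Unset Strict Implicit.
Unset Printing Implicit Defensive.

Import GRing.Theory.
Local Open Scope classical_set_scope.
Local Open Scope ring_scope.

(* Indices are 0-based: the generator called x_k on paper, 1 <= k <= N, is the
   one of index k - 1 : 'I_N. Permutations are elements of {perm 'I_N}. *)

Section Generation.
Variables (K B : pzRingType) (iota : K -> B).

(* The subalgebra generated by S, for the K-algebra structure on B with
   structure map iota. (The library has no K-algebra structure on the field of
   fractions of a K-algebra.) *)
Inductive subalg_gen (S : set B) : set B :=
| subalg_const c : subalg_gen S (iota c)
| subalg_mem b : S b -> subalg_gen S b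
| subalg_add a b : subalg_gen S a -> subalg_gen S b -> subalg_gen S (a + b)
| subalg_mul a b : subalg_gen S a -> subalg_gen S b -> subalg_gen S (a * b).

Inductive mult_gen (S : set B) : set B :=
| mult_one : mult_gen S 1
| mult_mem b : S b -> mult_gen S b
| mult_mul a b : mult_gen S a -> mult_gen S b -> mult_gen S (a * b).

End Generation.

Section PoissonAlgebra.
Variables (K : fieldType) (R : comAlgType K).
Implicit Types (A : set R) (br : R -> R -> R) (sigma delta : R -> R).

Definition derivation_on A (d : R -> R) : Prop :=
  [/\ forall a, A a -> A (d a),
      forall (c : K) a b, A a -> A b -> d (c *: a + b) = c *: d a + d b
    & forall a b, A a -> A b -> d (a * b) = d a * b + a * d b].

Definition poisson_bracket br : Prop :=
  [/\ forall a, derivation_on setT (br a),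
      forall b, derivation_on setT (br ^~ b),
      forall a, br a a = 0
    & forall a b c, br a (br b c) + br b (br c a) + br c (br a b) = 0].

Definition poisson_derivation_on br A sigma : Prop :=
  derivation_on A sigma /\
  forall a b, A a -> A b -> sigma (br a b) = br (sigma a) b + br a (sigma b).

Definition poisson_skew_derivation_on br A sigma delta : Prop :=
  derivation_on A delta /\
  forall a b, A a -> A b ->
    delta (br a b) = br (delta a) b + br a (delta b)
                     + sigma a * delta b - delta a * sigma b.

Definition locally_nilpotent_on A (d : R -> R) : Prop :=
  forall a, A a -> exists n : nat, iter n d a = 0.

Definition principal_ideal A (c : R) : set R := [set a * c | a in A].

(* c is a Poisson-prime element of the subalgebra A; the last two clauses say
   that A / Ac is a domain. *)
Definition poisson_prime br A (c : R) : Prop :=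
  [/\ A c, c != 0,
      forall a, A a -> principal_ideal A c (br c a),
      ~ principal_ideal A c 1
    & forall a b, A a -> A b -> principal_ideal A c (a * b) ->
        principal_ideal A c a \/ principal_ideal A c b].

End PoissonAlgebra.

Section TorusAction.
Variables (K : fieldType) (r : nat) (R : comAlgType K).
(* The torus (K^* )^r is the set of row vectors without zero entry, with entrywise
   product; its Lie algebra is 'rV[K]_r. *)
Implicit Types (h g xi : 'rV[K]_r) (act lie : 'rV[K]_r -> R -> R).

Definition torus : set 'rV[K]_r := [set h | forall i, h 0 i != 0].

Definition torus_mul h g : 'rV[K]_r := \row_i (h 0 i * g 0 i).

(* action by K-algebra automorphisms *)
Definition torus_action act : Prop :=
  [/\ forall h, torus h -> linear (act h),
      forall h, torus h -> monoid_morphism (act h),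
      forall a, act (const_mx 1) a = a
    & forall h g a, torus h -> torus g -> act (torus_mul h g) a = act h (act g a)].

Definition poisson_action br act : Prop :=
  torus_action act /\
  forall h a b, torus h -> act h (br a b) = br (act h a) (act h b).

Definition eigenvector act (a : R) : Prop :=
  a != 0 /\ exists chi : 'rV[K]_r -> K, forall h, torus h -> act h a = chi h *: a.

Definition homogeneous act (a : R) : Prop := a = 0 \/ eigenvector act a.

Definition has_weight act (u : 'I_r -> int) (a : R) : Prop :=
  forall h, torus h -> act h a = (\prod_(i < r) h 0 i ^ u i) *: a.

(* A torus action is rational when the algebra is the sum of its eigenspaces for
   the rational characters, i.e. for the h |-> \prod_i h_i ^ u_i, u in Z^r. *)
Definition rational_action act : Prop :=
  forall a, exists (n : nat) (u : 'I_n -> 'I_r -> int) (b : 'I_n -> R),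
    (forall i, has_weight act (u i) (b i)) /\ a = \sum_(i < n) b i.

(* lie is the differential of act; for K of characteristic 0 and a rational act,
   this determines lie. *)
Definition lie_differential act lie : Prop :=
  (forall xi, linear (lie xi)) /\
  forall xi u a, has_weight act u a ->
    lie xi a = (\sum_(i < r) (u i)%:~R * xi 0 i) *: a.

End TorusAction.

Section LevelSets.
Variables (N : nat) (eta : 'I_N -> int).

(* None stands for -oo in level_pred and for +oo in level_succ. *)
Definition level_pred (k : 'I_N) : option 'I_N :=
  [pick j : 'I_N | [&& (j < k)%N, eta j == eta k &
    [forall i : 'I_N, ((i < k)%N && (eta i == eta k)) ==> (i <= j)%N]]].

Definition level_succ (k : 'I_N) : option 'I_N :=
  [pick j : 'I_N | [&& (k < j)%N, eta j == eta k &
    [forall i : 'I_N, ((k < i)%N && (eta i == eta k)) ==> (j <= i)%N]]].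

End LevelSets.

Section PCGL.
Variables (K : fieldType) (N r : nat).
Notation R := {mpoly K[N]}.
Implicit Types (br : R -> R -> R) (act lie : 'rV[K]_r -> R -> R).
Implicit Types (sigma delta : 'I_N -> R -> R) (t : {perm 'I_N}).

(* The subalgebra K[x_{t(i)} | P i]; for t = 1 and P i := (i < k), this is R_k. *)
Definition gen_sub t (P : pred 'I_N) : set R :=
  subalg_gen (@mpolyC N K) [set 'X_(t i) | i in [set i | P i]].

Definition initial_sub t (m : nat) : set R := gen_sub t (fun i => (i < m)%N).

(* The polynomial algebra in N variables, with the bracket br, is the iterated
   Poisson-Ore extension given by sigma and delta. Only the restrictions of
   sigma k and delta k to initial_sub 1 k matter; for k = 0 these are derivations
   of K, hence zero. *)
Record is_PCGL br act lie sigma delta : Prop := {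
  PCGL_bracket : poisson_bracket br;
  PCGL_action : poisson_action br act;
  PCGL_rational : rational_action act;
  PCGL_lie : lie_differential act lie;
  PCGL_sigma : forall k : 'I_N,
    poisson_derivation_on br (initial_sub 1%g k) (sigma k);
  PCGL_delta : forall k : 'I_N,
    poisson_skew_derivation_on br (initial_sub 1%g k) (sigma k) (delta k);
  PCGL_ore : forall (k : 'I_N) b, initial_sub 1%g k b ->
    br 'X_k b = sigma k b * 'X_k + delta k b;
  PCGL_eigen : forall k : 'I_N, eigenvector act ('X_k : R);
  PCGL_nilpotent : forall k : 'I_N,
    locally_nilpotent_on (initial_sub 1%g k) (delta k);
  PCGL_h : forall k : 'I_N, exists (h : 'rV[K]_r) (lam : K),
    [/\ forall b, initial_sub 1%g k b -> sigma k b = lie h b,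
        lie h 'X_k = lam *: 'X_k & lam != 0] }.

Definition symmetric_PCGL lie sigma delta : Prop :=
  (forall j k : 'I_N, (j < k)%N ->
     gen_sub 1%g (fun i => (j < i < k)%N) (delta k 'X_j)) /\
  (forall j : 'I_N, exists (hs : 'rV[K]_r) (lams : K),
     [/\ forall k : 'I_N, (j < k)%N -> exists lam_kj : K,
           sigma k 'X_j = lam_kj *: 'X_j /\ lie hs 'X_k = - lam_kj *: 'X_k,
         lie hs 'X_j = lams *: 'X_j & lams != 0]).

(* For the presentation with generators adjoined in the order
   x_{t(1)}, ..., x_{t(N)}, eta is an eta-function and y is the sequence of
   homogeneous Poisson-prime elements. *)
Definition prime_sequence br act t (eta : 'I_N -> int) (y : 'I_N -> R) : Prop :=
  [/\ forall k : 'I_N,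
        match level_pred eta k with
        | None => y k = 'X_(t k)
        | Some j => exists c : R,
            [/\ initial_sub t k c, homogeneous act c & y k = y j * 'X_(t k) - c]
        end,
      forall k : 'I_N, homogeneous act (y k)
    & forall m : nat, (1 <= m <= N)%N ->
        let last_in_level (j : 'I_N) :=
          (j < m)%N /\ (forall l, level_succ eta j = Some l -> (m <= l)%N) in
        (forall j, last_in_level j -> poisson_prime br (initial_sub t m) (y j)) /\
        (forall z, homogeneous act z -> poisson_prime br (initial_sub t m) z ->
           exists j, last_in_level j /\ exists2 a : K, a != 0 & z = a *: y j)].

End PCGL.

Section Permutations.
Variable N : nat.

Definition Xi : set {perm 'I_N} :=
  [set t : {perm 'I_N} | forall m : nat, (2 <= m <= N)%N ->
    let img (a : 'I_N) := exists2 i : 'I_N, (i < m)%N & t i = a in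
    forall a b c : 'I_N, img a -> img c -> (a <= b <= c)%N -> img b].

(* One-line notation, with values in [1, N]. *)
Definition Gamma : set {perm 'I_N} :=
  [set t : {perm 'I_N} | exists i j : nat, [&& 1 <= i, i <= j & j <= N]%N /\
    [seq (t k).+1 | k <- enum 'I_N] =
      iota i.+1 (j - i) ++ [:: i] ++ iota j.+1 (N - j) ++ rev (iota 1 i.-1)].

End Permutations.

(* Everything below is a subset of Fract(R). *)
Section Localizations.
Variables (K : fieldType) (N : nat).
Notation R := {mpoly K[N]}.
Notation F := {fraction {mpoly K[N]}}.

Definition to_fract : R -> F := @FracField.tofrac R.

Definition fract_gen : set F -> set F :=
  subalg_gen (fun c : K => to_fract c%:MP).

Definition poly_ring : set F := range to_fract.

Definition cluster_alg (y : 'I_N -> R) : set F :=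
  to_fract @` subalg_gen (@mpolyC N K) (range y).

Definition cluster_torus (y : 'I_N -> R) : set F :=
  fract_gen ([set to_fract (y k) | k in setT]
             `|` [set (to_fract (y k))^-1 | k in setT]).

Definition cluster_denom (eta : 'I_N -> int) (y : 'I_N -> R) : set F :=
  to_fract @` mult_gen ([set c%:MP | c in [set c : K | c != 0]]
                        `|` [set y k | k in [set k | level_succ eta k <> None]]).

(* A[E^-1], for a multiplicative set E *)
Definition localize (A E : set F) : set F := [set a / e | a in A & e in E].

(* A[s^-1 | s in S] *)
Definition adjoin_inv (A S : set F) : set F :=
  fract_gen (A `|` [set s^-1 | s in S]).

End Localizations.

Arguments poly_ring : clear implicits.

(* Main.v *)
Require Import Defs.
From HB Require Import structures.
From mathcomp Require Import all_boot all_order all_fingroup all_algebra.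
From mathcomp Require Import boolp classical_sets.
From mathcomp Require Import fraction mpoly.
From mathcomp Require Import zify.

Set Implicit Arguments.
Unset Strict Implicit.
Unset Printing Implicit Defensive.

Import GRing.Theory.
Local Open Scope classical_set_scope.
Local Open Scope ring_scope.

(** Every denominator in the theorem is, up to a nonzero scalar, a product of
    elements y_(t,k), and these are prime elements of the whole polynomial
    ring R: y_(t,k) is prime in the polynomial subring generated by x_(t(1)),
    ..., x_(t(k)), and by Gauss's lemma adjoining the remaining variables keeps
    it prime ([prime_elt_full]). All the localizations can therefore be compared by
    cancelling primes.

    Parts (a), (b), (c) come from the recursion y_k = y_(p(k)) x_k - c_k. It
    gives x_k = (y_k + c_k) / y_(p(k)), where p(k) has the successor k, so its
    prime is allowed in denominators; by induction every polynomial is a quotient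
    of elements of the cluster algebra ([cluster_denominator]). If k is the
    first position then y_k = x_(t(k)), and every generator of R is adjoined
    first for some t in Gamma, which is (b).

    Parts (d) and (e) rest on [mutable_prime_avoided]: if s(k) is finite, then
    for some t in Gamma the prime q = y_k of the original presentation is
    associated to no y_(t,l). Let x_i be the first variable that q depends on,
    and let t adjoin x_(i+1), ..., x_N, x_i, x_(i-1), ..., x_1 in this order.
    Among the variables on which y_(t,l) depends, x_(t(l)) is the last one in
    this order; so an associate y_(t,l) of q has t(l) = i, and q is
    Poisson-normal in the subalgebra generated by x_i, ..., x_N. But q is also
    Poisson-normal in the subalgebra generated by x_1, ..., x_k, and i <= k, so
    it is Poisson-normal, hence Poisson-prime, in R. The homogeneous Poisson-primes of R are the y_j
    with s(j) infinite, and y_j is not associated to y_k for j != k, a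
    contradiction.

    Now let f lie in the intersection of the localizations and write
    f = a / (e m), with e a product of such primes q and m a product of y_j with
    j in inv. For each q, the expression of f over the denominators of the t
    just found shows that q divides a times a product of primes not associated
    to q, so q divides a. Cancelling the factors of e one at a time leaves
    f = b / m ([mutable_monomial_cancel], [mixed_denominator_cancel]). *)

(** * Prime elements of a subring and Gauss's lemma *)
Section PrimeElements.
Variables (K : fieldType) (R : comAlgType K).
Implicit Types (S : set R) (q : R).

Definition subring_set S : Prop :=
  [/\ S 1, forall a b, S a -> S b -> S (a - b)
    & forall a b, S a -> S b -> S (a * b)].

(** Primality is relative to a subring S, so that it can be carried from the
    subring where y_k is known to be prime up to the whole polynomial ring. *)
Definition prime_elt S q : Prop :=
  [/\ S q, q != 0, ~ principal_ideal S q 1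
    & forall a b, S a -> S b -> principal_ideal S q (a * b) ->
        principal_ideal S q a \/ principal_ideal S q b].

Lemma subring_set0 S : subring_set S -> S 0.
Proof. by case=> S1 SB _; rewrite -(subrr 1); apply: SB. Qed.

Lemma subring_setD S a b : subring_set S -> S a -> S b -> S (a + b).
Proof.
move=> subS Sa Sb; have S0 := subring_set0 subS; case: subS => _ SB _.
by rewrite -[b]opprK -[- b]sub0r; apply: (SB) => //; apply: SB.
Qed.

Lemma principal_idealB S q a b : subring_set S ->
  principal_ideal S q a -> principal_ideal S q b -> principal_ideal S q (a - b).
Proof.
by move=> [_ SB _] [u Su <-] [v Sv <-]; exists (u - v); [exact: SB | rewrite mulrBl].
Qed.

Lemma principal_ideal0 S q : subring_set S -> principal_ideal S q 0.
Proof. by move=> /subring_set0 S0; exists 0; rewrite ?mul0r. Qed.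

Lemma principal_idealD S q a b : subring_set S ->
  principal_ideal S q a -> principal_ideal S q b -> principal_ideal S q (a + b).
Proof.
by move=> subS [u Su <-] [v Sv <-]; exists (u + v);
  [exact: subring_setD | rewrite mulrDl].
Qed.

Lemma principal_idealMl S q a b : subring_set S -> S a ->
  principal_ideal S q b -> principal_ideal S q (a * b).
Proof.
by move=> [_ _ SM] Sa [u Su <-]; exists (a * u); [exact: SM | rewrite mulrA].
Qed.

Lemma principal_idealMr S q a b : subring_set S -> S b ->
  principal_ideal S q a -> principal_ideal S q (a * b).
Proof. by move=> subS Sb Ia; rewrite mulrC; apply: principal_idealMl. Qed.

Lemma principal_ideal_sum S q n (F : 'I_n -> R) (P : pred 'I_n) :
  subring_set S -> (forall i, P i -> principal_ideal S q (F i)) ->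
  principal_ideal S q (\sum_(i < n | P i) F i).
Proof.
move=> subS IF; elim/big_ind: _ => //; first exact: principal_ideal0.
by move=> a b; apply: principal_idealD.
Qed.

(** If f_i and g_j are the first coefficients not divisible by q, every other term
    of the coefficient of degree i + j of f * g is divisible by q, so f_i * g_j
    would be divisible too. The coefficients stay in R, with membership in S as
    a hypothesis, because S is only a subset and not a ring type. *)
Lemma gauss_lemma S q (f g : {poly R}) : subring_set S -> prime_elt S q ->
  (forall i, S f`_i) -> (forall i, S g`_i) ->
  (forall i, principal_ideal S q (f * g)`_i) ->
  (forall i, principal_ideal S q f`_i) \/ (forall i, principal_ideal S q g`_i).
Proof.
move=> subS [_ _ _ primeq] Sf Sg Ifg; apply: contrapT => /not_orP[].
move=> /existsNP[i0 Ni0] /existsNP[j0 Nj0].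
have minimal (h : {poly R}) (k : nat) : ~ principal_ideal S q h`_k ->
    exists2 i : nat, ~ principal_ideal S q h`_i
      & forall j : nat, (j < i)%N -> principal_ideal S q h`_j.
  move=> Nk; pose P i := `[< ~ principal_ideal S q h`_i >].
  have exP : exists i, P i by exists k; apply/asboolP.
  case: (ex_minnP exP) => i /asboolP Ni min_i; exists i => // j lt_ji.
  by apply: contrapT => /asboolP/min_i; rewrite leqNgt lt_ji.
have [i Ni ltI] := minimal _ _ Ni0; have [j Nj ltJ] := minimal _ _ Nj0.
have := Ifg (i + j)%N; rewrite coefM.
have lt_i : (i < (i + j).+1)%N by rewrite ltnS leq_addr.
rewrite (bigD1 (Ordinal lt_i)) //= addKn; set rest := (X in _ + X) => Iall.
have Irest : principal_ideal S q rest.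
  apply: principal_ideal_sum => // k neq_k; have [lt_ki|le_ik] := ltnP k i.
    by apply: principal_idealMr => //; apply: ltI.
  apply: principal_idealMl => //; apply: ltJ.
  by have := ltn_ord k; move: neq_k; rewrite -val_eqE /=; lia.
have := principal_idealB subS Iall Irest; rewrite addrK.
by case/primeq.
Qed.

End PrimeElements.

(** * Adjoining a variable to a polynomial subring *)
Section Variables.
Variables (K : fieldType) (N : nat).
Notation R := {mpoly K[N]}.
Implicit Types (a b q : R) (t : {perm 'I_N}) (P : pred 'I_N).

(** A polynomial seen as a polynomial in x_j whose coefficients are polynomials in
    the other variables. The coefficients are kept in R itself, so that the
    variables can be split off one after the other without changing the type. *)
Definition in_var (j : 'I_N) : R -> {poly R} :=
  mmap (polyC \o @mpolyC N K) (fun k => if k == j then 'X else ('X_k)%:P).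

HB.instance Definition _ j := GRing.RMorphism.on (in_var j).

Lemma in_varC j (c : K) : in_var j c%:MP = c%:MP%:P.
Proof. exact: mmapC. Qed.

Lemma in_varX j k : in_var j 'X_k = if k == j then 'X else ('X_k)%:P.
Proof. by rewrite /in_var mmapX mmap1U. Qed.

(* Unification must not unfold [in_var] to a sum over the monomials of its
   argument. *)
Local Opaque in_var.

Lemma subring_gen_sub t P : subring_set (@gen_sub K N t P).
Proof.
split; first by rewrite -mpolyC1; apply: subalg_const.
  move=> a b Sa Sb; rewrite -mulN1r -mpolyC1 -mpolyCN.
  by apply: subalg_add => //; apply: subalg_mul => //; apply: subalg_const.
by move=> a b; apply: subalg_mul.
Qed.

Lemma gen_sub_var t P i : P i -> gen_sub t P ('X_(t i) : R).
Proof. by move=> Pi; apply: subalg_mem; exists i. Qed.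

Lemma gen_sub_le t P P' a : (forall i, P i -> P' i) ->
  gen_sub t P a -> gen_sub t P' a.
Proof.
move=> PP'; elim=> [c|b [i Pi <-]|b c _ + _|b c _ + _].
- exact: subalg_const.
- exact/gen_sub_var/PP'.
- exact: subalg_add.
- exact: subalg_mul.
Qed.

Lemma gen_sub_in_var t P i a : ~~ P i -> gen_sub t P a ->
  in_var (t i) a = a%:P.
Proof.
move=> Pi; elim=> [c|b [k Pk <-]|b c _ IHb _ IHc|b c _ IHb _ IHc].
- exact: in_varC.
- rewrite in_varX (inj_eq perm_inj); case: eqP => // eq_ki.
  by rewrite -eq_ki Pk in Pi.
- by rewrite !rmorphD /= IHb IHc.
- by rewrite !rmorphM /= IHb IHc.
Qed.

Lemma in_var_at j a : (in_var j a).['X_j] = a.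
Proof.
elim/mpolyind: a => [|c m a _ _ IHa].
  by rewrite rmorph0 horner0.
rewrite rmorphD hornerD; congr (_ + _); last exact: IHa.
rewrite -mul_mpolyC rmorphM /=.
rewrite in_varC hornerCM; congr (_ * _).
rewrite mpolyXE_id rmorph_prod horner_prod; apply: eq_bigr => k _.
rewrite rmorphXn horner_exp /= in_varX.
by case: eqP => [->|_]; rewrite ?hornerX ?hornerC.
Qed.

Lemma initial_sub_coef t (m : 'I_N) a : initial_sub t m.+1 a ->
  forall i, initial_sub t m (in_var (t m) a)`_i.
Proof.
have subS := subring_gen_sub t (fun i => (i < m)%N).
have S0 := subring_set0 subS; have S1 : initial_sub t m (1 : R) by case: subS.
elim=> [c|b [k /= lek <-]|b c _ IHb _ IHc|b c _ IHb _ IHc] i.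
- by rewrite in_varC coefC; case: ifP => // _; apply: subalg_const.
- rewrite in_varX (inj_eq perm_inj); case: eqP => [_|neq_km].
    by rewrite coefX; case: eqP.
  rewrite coefC; case: ifP => // _; apply: gen_sub_var.
  by rewrite ltn_neqAle -ltnS lek andbT; apply/eqP=> /val_inj.
- rewrite rmorphD coefD.
  exact: subalg_add (IHb i) (IHc i).
- rewrite rmorphM coefM.
  elim/big_ind: _ => [|u v|k _]; first exact: S0.
    exact: subalg_add.
  exact: subalg_mul (IHb _) (IHc _).
Qed.

Lemma initial_sub_full t m : (N <= m)%N -> initial_sub t m = [set: R].
Proof.
move=> leNm; apply/seteqP; split=> // a _.
have subS := subring_gen_sub t (fun i => (i < m)%N).
have S0 := subring_set0 subS; have S1 : initial_sub t m (1 : R) by case: subS.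
have SX k : initial_sub t m ('X_k : R).
  by rewrite -(permKV t k); apply: gen_sub_var; apply: leq_trans leNm.
elim/mpolyind: a => // c n a _ _ Sa; apply: subalg_add => //.
rewrite -mul_mpolyC; apply: subalg_mul; first exact: subalg_const.
rewrite mpolyXE_id; elim/big_ind: _ => // [u v|k _]; first exact: subalg_mul.
elim: (n k) => [|d IHd]; first by rewrite expr0.
by rewrite exprS; apply: subalg_mul (SX k) IHd.
Qed.

(** Seen as a polynomial in the new variable x, q is constant, so an element is a
    multiple of q exactly when all its coefficients in x are: Gauss's lemma
    applies to these coefficients. *)
Lemma prime_elt_step t (m : 'I_N) q :
  prime_elt (initial_sub t m) q -> prime_elt (initial_sub t m.+1) q.
Proof.
move=> primeq; have [Sq q0 q1 _] := primeq.
have leS a : initial_sub t m a -> initial_sub t m.+1 a.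
  by apply: gen_sub_le => i; apply: ltnW.
have subS := subring_gen_sub t (fun i => (i < m)%N).
have subS' := subring_gen_sub t (fun i => (i < m.+1)%N).
have qC : in_var (t m) q = q%:P by apply: gen_sub_in_var Sq; rewrite ltnn.
have coefI a : principal_ideal (initial_sub t m.+1) q a ->
    forall i, principal_ideal (initial_sub t m) q (in_var (t m) a)`_i.
  move=> [b Sb <-] i; exists (in_var (t m) b)`_i; first exact: initial_sub_coef.
  by rewrite rmorphM /= qC coefMC.
have evalI a : (forall i, principal_ideal (initial_sub t m) q (in_var (t m) a)`_i) ->
    principal_ideal (initial_sub t m.+1) q a.
  move=> Ia; rewrite -[a](in_var_at (t m)) horner_coef.
  apply: principal_ideal_sum => // i _; apply: principal_idealMr => //.
    case: subS' => S'1 _ S'M; elim: (val i) => [|d IHd]; first by rewrite expr0.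
    by rewrite exprS; apply: S'M IHd; apply: gen_sub_var.
  by have [b Sb <-] := Ia i; exists b => //; apply: leS.
split=> //; first exact: leS.
  by move=> /coefI/(_ 0%N); rewrite rmorph1 coef1.
move=> a b Sa Sb /coefI Iab.
have [||] := gauss_lemma subS primeq (initial_sub_coef Sa) (initial_sub_coef Sb).
- by move=> i; rewrite -rmorphM.
- by move=> Ia; left; apply: evalI.
- by move=> Ib; right; apply: evalI.
Qed.

Lemma prime_elt_full t m q : (m <= N)%N ->
  prime_elt (initial_sub t m) q -> prime_elt setT q.
Proof.
move=> le_mN primeq; rewrite -(initial_sub_full t (leqnn N)).
have [d def_N] : exists d, (N = d + m)%N by exists (N - m)%N; rewrite subnK.
have: (d + m <= N)%N by rewrite -def_N.
rewrite [X in initial_sub t X]def_N {def_N}.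
elim: d => [|d IHd] lt_dN //.
by apply: (@prime_elt_step t (Ordinal lt_dN)); apply: IHd; apply: ltnW.
Qed.

End Variables.

(** * Predecessors and successors in the level sets *)
Section LevelSets.
Variables (N : nat) (eta : 'I_N -> int).

Lemma level_pred_lt k j : level_pred eta k = Some j -> (j < k)%N.
Proof. by rewrite /level_pred; case: pickP => // i /and3P[lt_ik _ _] [<-]. Qed.

Lemma level_succ_gt k j : level_succ eta k = Some j -> (k < j)%N.
Proof. by rewrite /level_succ; case: pickP => // i /and3P[lt_ik _ _] [<-]. Qed.

(** The recursion for y_k divides by y_(p(k)); since s(p(k)) = k is finite, that
    denominator is an allowed one. *)
Lemma level_pred_succ k j :
  level_pred eta k = Some j -> level_succ eta j = Some k.
Proof.
rewrite /level_pred; case: pickP => // i /and3P[lt_ik /eqP eta_ik /forallP max_i] [<-].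
have next_k (l : 'I_N) : (i < l)%N -> eta l = eta i -> (k <= l)%N.
  move=> lt_il eta_l; rewrite leqNgt; apply/negP=> lt_lk.
  by have := max_i l; rewrite lt_lk eta_l eta_ik eqxx /= leqNgt lt_il.
rewrite /level_succ; case: pickP => [l|/(_ k)].
  case/and3P=> lt_il /eqP eta_l /forallP/(_ k).
  rewrite lt_ik eta_ik eqxx /= => le_lk; congr Some; apply: val_inj; apply/eqP.
  by rewrite eqn_leq le_lk next_k.
rewrite lt_ik eta_ik eqxx /= => /negP[]; apply/forallP=> l.
by apply/implyP=> /andP[lt_il /eqP eta_l]; apply: next_k => //; rewrite eta_l.
Qed.

End LevelSets.

(** * Divisibility and dependence on a variable *)
Lemma linear_constant (D : nzRingType) (a c d : D) :
  a%:P * 'X - c%:P = d%:P -> a = 0.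
Proof.
move/(congr1 (fun f : {poly D} => f`_1)).
by rewrite coefB coefMX !coefC /= subr0.
Qed.

Section Divisibility.
Variables (K : fieldType) (N : nat).
Notation R := {mpoly K[N]}.
Implicit Types (a b p q : R).

Definition free_of (j : 'I_N) (a : R) := in_var j a = a%:P.

Lemma in_var_inj j : injective (@in_var K N j).
Proof. exact: (can_inj (g := fun f => f.['X_j]) (@in_var_at K N j)). Qed.

(** Degrees in x_j add up in a product. *)
Lemma free_of_divisor j p q :
  q != 0 -> principal_ideal setT p q -> free_of j q -> free_of j p.
Proof.
move=> q0 [a _ def_q] free_q; have := q0; rewrite -def_q mulf_eq0 => /norP[a0 p0].
have nz b : b != 0 -> in_var j b != 0.
  by move=> b0; rewrite -(rmorph0 (in_var j)) (inj_eq (@in_var_inj j)).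
have : size (in_var j q) = 1%N by rewrite free_q size_polyC q0.
rewrite -def_q rmorphM /= size_mul ?nz // => size_q.
have le1 (u v : nat) : (u + v).-1 = 1%N -> (0 < u)%N -> (v <= 1)%N by lia.
have /size1_polyC def_p : (size (in_var j p) <= 1)%N.
  by apply: le1 size_q _; rewrite size_poly_gt0 nz.
move: def_p; set c := _`_0 => def_p.
have def_c : c = p by rewrite -[RHS](in_var_at j) def_p hornerC.
by rewrite /free_of def_p def_c.
Qed.

Lemma subring_setT : subring_set [set: R].
Proof. by split. Qed.

(** If p = a q and p divided a, then q would be a unit; as p divides a q, it
    divides q. *)
Lemma prime_elt_assoc p q : prime_elt setT p -> prime_elt setT q ->
  principal_ideal setT q p -> principal_ideal setT p q.
Proof.
move=> [_ p0 _ primep] [_ _ q1 _] [a _ def_p].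
have pdvd : principal_ideal setT p (a * q) by exists 1; rewrite ?mul1r.
have [[b _ def_a]|//] := primep a q I I pdvd.
case: q1; exists b => //; apply: (mulfI p0); rewrite mulr1 -[RHS]def_p -def_a.
by rewrite mulrCA mulrA mulrAC.
Qed.

End Divisibility.

(** * Elements that generate a Poisson ideal *)
Section Normal.
Variables (K : fieldType) (N : nat) (br : {mpoly K[N]} -> {mpoly K[N]} -> {mpoly K[N]}).
Notation R := {mpoly K[N]}.
Hypothesis br_poisson : poisson_bracket br.
Implicit Types (a b p q : R).

Lemma poisson_prime_elt S q : poisson_prime br S q -> prime_elt S q.
Proof. by case. Qed.

Lemma bracketDr q a b : br q (a + b) = br q a + br q b.
Proof.
case: br_poisson => /(_ q)[_ lin _] _ _ _.
by rewrite -[a]scale1r lin // !scale1r.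
Qed.

Lemma bracketMr q a b : br q (a * b) = br q a * b + a * br q b.
Proof. by case: br_poisson => /(_ q)[_ _ ->]. Qed.

Lemma bracketMl q a b : br (a * b) q = br a q * b + a * br b q.
Proof. by case: br_poisson => _ /(_ q)[_ _ ->]. Qed.

Lemma bracketC q (c : K) : br q c%:MP = 0.
Proof.
have br1 : br q 1 = 0.
  have := bracketMr q 1 1; rewrite !mulr1 mul1r => /eqP.
  by rewrite -subr_eq0 opprD addNKr oppr_eq0 => /eqP.
have br0 : br q 0 = 0.
  by have := bracketMr q 0 0; rewrite !mulr0 mul0r addr0.
case: br_poisson => /(_ q)[_ lin _] _ _ _.
by rewrite -[c%:MP]mulr1 mul_mpolyC -[c *: 1]addr0 lin // br1 br0 scaler0 addr0.
Qed.

(** With q = b p, the Leibniz rule gives br q a = br b a * p + b * br p a, a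
    multiple of p and hence of its associate q. *)
Lemma normal_assoc p q a :
  principal_ideal setT p q -> principal_ideal setT q p ->
  principal_ideal setT p (br p a) -> principal_ideal setT q (br q a).
Proof.
move=> [b _ def_q] [c _ def_p] [d _ def_br].
exists (br b a * c + b * d * c) => //.
rewrite /= in def_q def_p def_br.
by rewrite -[in RHS]def_q bracketMl -def_br mulrDl -!mulrA def_p.
Qed.

(** [br q] is a derivation, so the elements that it sends into R q form a subalgebra. *)
Lemma normal_generated q : (forall j, principal_ideal setT q (br q 'X_j)) ->
  forall a, principal_ideal setT q (br q a).
Proof.
move=> Iq a; have subT := @subring_setT K N.
have : initial_sub 1%g N a by rewrite initial_sub_full.
elim=> {a} [c|_ [j _ <-]|a b _ Ia _ Ib|a b _ Ia _ Ib].
- by rewrite bracketC; apply: principal_ideal0.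
- exact: Iq.
- by rewrite bracketDr; apply: principal_idealD.
- rewrite bracketMr; apply: principal_idealD => //.
    exact: principal_idealMr.
  exact: principal_idealMl.
Qed.

End Normal.

(** * The prime sequence of one presentation *)
Section PrimeSequence.
Variables (K : fieldType) (N r : nat) (br : {mpoly K[N]} -> {mpoly K[N]} -> {mpoly K[N]})
  (act : 'rV[K]_r -> {mpoly K[N]} -> {mpoly K[N]}) (t : {perm 'I_N}) (eta : 'I_N -> int)
  (y : 'I_N -> {mpoly K[N]}).
Hypothesis y_prime : prime_sequence br act t eta y.
Implicit Types k l : 'I_N.

(** The successor of k lies beyond k, so y_k is one of the Poisson-primes listed
    for the subalgebra generated by the first k variables. *)
Lemma sequence_poisson_prime k : poisson_prime br (initial_sub t k.+1) (y k).
Proof.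
case: y_prime => _ _ /(_ k.+1 (ltn_ord k))[+ _]; apply; split=> // l.
exact: level_succ_gt.
Qed.

Lemma sequence_prime k : prime_elt setT (y k).
Proof.
by apply: prime_elt_full (ltn_ord k) (poisson_prime_elt (sequence_poisson_prime k)).
Qed.

Lemma sequence_neq0 k : y k != 0.
Proof. by case: (sequence_prime k). Qed.

Lemma sequence_initial k : initial_sub t k.+1 (y k).
Proof. by case: (sequence_poisson_prime k). Qed.

Lemma sequence_normal k a : initial_sub t k.+1 a ->
  principal_ideal setT (y k) (br (y k) a).
Proof.
by case: (sequence_poisson_prime k) => _ _ + _ _ => /[apply] -[b _ <-]; exists b.
Qed.

Lemma sequence_free k l : (k < l)%N -> free_of (t l) (y k).
Proof.
move=> lt_kl; apply: (gen_sub_in_var _ (sequence_initial k)).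
by rewrite /= -leqNgt.
Qed.

(** y_k is linear in the k-th variable, with leading coefficient 1 or
    y_(p(k)), which is not zero. Together with [sequence_free], this makes the
    k-th variable the last one on which y_k depends. *)
Lemma sequence_not_free k : ~ free_of (t k) (y k).
Proof.
move=> free_k; case: y_prime => /(_ k) + _ _.
case def_p: (level_pred eta k) => [p|] => [[c [Sc _ def_y]]|def_y].
  have lt_pk := level_pred_lt def_p.
  have free_c : free_of (t k) c by apply: gen_sub_in_var Sc; rewrite /= ltnn.
  move: free_k; rewrite def_y /free_of rmorphB rmorphM /= in_varX eqxx.
  rewrite (sequence_free lt_pk) free_c => /linear_constant/eqP.
  by rewrite (negbTE (sequence_neq0 p)).
move: free_k; rewrite def_y /free_of in_varX eqxx => /eqP.
rewrite -[X in X == _]mul1r -[X in X == _]subr0 => /eqP/linear_constant/eqP.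
by rewrite oner_eq0.
Qed.

(** Associates depend on the same variables, and k is recovered from y_k as the
    position of the last variable on which it depends. *)
Lemma sequence_assoc_inj k l : principal_ideal setT (y k) (y l) -> k = l.
Proof.
move=> Ikl; have Ilk := prime_elt_assoc (sequence_prime l) (sequence_prime k) Ikl.
apply: val_inj; case: (ltngtP k l) => // [lt_kl|lt_lk].
  have := sequence_free lt_kl.
  by move/(free_of_divisor (sequence_neq0 k) Ilk)/sequence_not_free.
have := sequence_free lt_lk.
by move/(free_of_divisor (sequence_neq0 l) Ikl)/sequence_not_free.
Qed.

End PrimeSequence.

(** * The permutations in Gamma *)
Section Permutations.
Variable N : nat.

(** [line i j] is the one-line notation of tau_(i,j), with values in [1, N];
    [line_fun i j] is the same permutation on indices starting from 0. *)
Definition line (i j : nat) : seq nat :=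
  iota i.+1 (j - i) ++ [:: i] ++ iota j.+1 (N - j) ++ rev (iota 1 i.-1).

Definition line_fun (i j k : nat) : nat :=
  if (k < j - i)%N then (i + k)%N
  else if k == (j - i)%N then i.-1
  else if (k <= N - i)%N then (k + i).-1
  else (N - k).-1.

Lemma nth_line i j k : [&& 1 <= i, i <= j & j <= N]%N -> (k < N)%N ->
  nth 0%N (line i j) k = (line_fun i j k).+1.
Proof.
move=> /and3P[i1 ij jN] kN; rewrite /line /line_fun !nth_cat !size_iota /=.
case: ltnP => [lt1|ge1]; first by rewrite nth_iota //; lia.
case: eqP => [->|ne1]; first by rewrite subnn /= prednK.
have -> : (k - (j - i) < 1)%N = false by lia.
case: ltnP => [lt2|ge2].
  by rewrite nth_iota //; case: leqP; lia.
rewrite nth_rev ?size_iota; last by lia.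
by rewrite nth_iota; last lia; case: leqP; lia.
Qed.

Lemma size_line i j : [&& 1 <= i, i <= j & j <= N]%N -> size (line i j) = N.
Proof.
by move=> /and3P[i1 ij jN]; rewrite /line !size_cat size_rev !size_iota /=; lia.
Qed.

Lemma GammaP t : @Gamma N t <-> exists i j, [&& 1 <= i, i <= j & j <= N]%N /\
  forall k : 'I_N, t k = line_fun i j k :> nat.
Proof.
split=> -[i [j [ij def_t]]]; exists i, j; split=> //.
  move=> k; have := congr1 (nth 0%N ^~ k) def_t; rewrite -/(line i j) nth_line //.
  by rewrite (nth_map k) ?size_enum_ord // nth_ord_enum => -[].
apply: (@eq_from_nth _ 0%N); first by rewrite size_map size_enum_ord size_line.
move=> k; rewrite size_map size_enum_ord => kN; rewrite -/(line i j) nth_line //.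
by rewrite (nth_map (Ordinal kN)) ?size_enum_ord // (nth_ord_enum _ (Ordinal kN)) def_t.
Qed.

Lemma line_perm i j : [&& 1 <= i, i <= j & j <= N]%N ->
  exists t : {perm 'I_N}, forall k : 'I_N, t k = line_fun i j k :> nat.
Proof.
move=> ij; have ltN (k : 'I_N) : (line_fun i j k < N)%N.
  case: k => k kN /=; move/and3P: ij => [? ? ?]; rewrite /line_fun.
  by repeat case: ifP => ?; lia.
have inj_f : injective (fun k => Ordinal (ltN k)).
  move=> k l [] eq_kl; apply: val_inj; move: eq_kl => /=.
  case: k l => k kN [l lN] /=; move/and3P: ij => [? ? ?]; rewrite /line_fun.
  by repeat case: ifP => ?; lia.
by exists (perm inj_f) => k; rewrite permE.
Qed.

(** In each of the four segments of the one-line notation, an entry placed after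
    the first m lies outside the range of those m entries. *)
Lemma Gamma_Xi t : @Gamma N t -> Xi t.
Proof.
move=> /GammaP[i [j [/and3P[i1 ij jN] def_t]]] m _ img a b c [ka lt_ka <-] [kc lt_kc <-].
move=> abc; exists (t^-1 b)%g; last by rewrite permKV.
rewrite -(permKV t b) in abc; move: (t^-1 b)%g abc => kb.
rewrite !def_t /line_fun.
by have := ltn_ord ka; have := ltn_ord kb; have := ltn_ord kc; repeat case: ifP => ?; lia.
Qed.

Lemma Gamma_id : (0 < N)%N -> @Gamma N 1%g.
Proof.
move=> N0; apply/GammaP; exists 1%N, 1%N; split=> [|k]; first by rewrite N0.
by rewrite perm1 /line_fun; have := ltn_ord k; repeat case: ifP => ?; lia.
Qed.

(** The permutation tau_(i,N), which lists i+1, ..., N, i, i-1, ..., 1: the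
    variables adjoined up to x_i are those of index at least i. *)
Lemma Gamma_upper (i : 'I_N) : exists (t : {perm 'I_N}) (p : 'I_N),
  [/\ Gamma t, t p = i & forall l : 'I_N, (l <= p)%N = (i <= t l)%N].
Proof.
have iN := ltn_ord i.
have ij : [&& 1 <= i.+1, i.+1 <= N & N <= N]%N by rewrite iN leqnn.
have [t def_t] := line_perm ij.
have pN : (N - i.+1 < N)%N by lia.
exists t, (Ordinal pN); split; first by apply/GammaP; exists i.+1, N.
  apply: val_inj; rewrite /= def_t /line_fun /=.
  by repeat case: ifP => ?; lia.
by move=> l; have := ltn_ord l; rewrite def_t /line_fun /=; repeat case: ifP => ?; lia.
Qed.

(** The permutation tau_(i,i), which lists i first. *)
Lemma Gamma_first (i : 'I_N) : exists t : {perm 'I_N},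
  Gamma t /\ exists k : 'I_N, k = 0%N :> nat /\ t k = i.
Proof.
have iN := ltn_ord i.
have ij : [&& 1 <= i.+1, i.+1 <= i.+1 & i.+1 <= N]%N by rewrite iN leqnn.
have [t def_t] := line_perm ij.
have N0 : (0 < N)%N by lia.
exists t; split; first by apply/GammaP; exists i.+1, i.+1.
exists (Ordinal N0); split=> //; apply: val_inj; rewrite /= def_t /line_fun /=.
by rewrite subnn.
Qed.

End Permutations.

(** * Cancelling mutable primes *)
Section Families.
Variables (K : fieldType) (N r : nat) (br : {mpoly K[N]} -> {mpoly K[N]} -> {mpoly K[N]})
  (act : 'rV[K]_r -> {mpoly K[N]} -> {mpoly K[N]}) (eta : {perm 'I_N} -> 'I_N -> int)
  (y : {perm 'I_N} -> 'I_N -> {mpoly K[N]}).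
Hypothesis N_gt0 : (0 < N)%N.
Hypothesis br_poisson : poisson_bracket br.
Hypothesis y_prime : forall t, Xi t -> prime_sequence br act t (eta t) (y t).
Notation R := {mpoly K[N]}.
Implicit Types (k l : 'I_N) (t : {perm 'I_N}).

(** An associate of q = y_k in the presentation of [Gamma_upper], for the first
    variable x_i on which q depends, would make q Poisson-normal against
    x_i, ..., x_N. As q is Poisson-normal against x_1, ..., x_k, with i <= k, it
    would be a homogeneous Poisson-prime of R, hence associated to some y_j with
    s(j) infinite; then j = k, although s(k) is finite. *)
Lemma mutable_prime_avoided k : level_succ (eta 1%g) k <> None ->
  exists2 t, Gamma t & forall l, ~ principal_ideal setT (y 1%g k) (y t l).
Proof.
move=> succ_k.
have prime1 := y_prime (Gamma_Xi (Gamma_id N_gt0)).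
set q := y 1%g k; have q0 : q != 0 := sequence_neq0 prime1 k.
have dep_k : ~ free_of k q by rewrite -{1}(perm1 k); apply: sequence_not_free prime1 k.
have [i /asboolP dep_i min_i] : exists2 i : 'I_N, `[< ~ free_of i q >]
    & forall j : 'I_N, ~ free_of j q -> (i <= j)%N.
  pose P i := `[< ~ free_of i q >]; have Pk : P k by apply/asboolP.
  case: (arg_minnP (@nat_of_ord N) Pk) => i Pi min_i; exists i => // j /asboolP.
  exact: min_i.
have [t [p [Gt tp upper]]] := Gamma_upper i.
exists t => // l Iql; have prime_t := y_prime (Gamma_Xi Gt).
have Ilq := prime_elt_assoc (sequence_prime prime_t l) (sequence_prime prime1 k) Iql.
(* t l = i: no variable before x_i occurs in q, and x_i does. *)
have le_lp : (l <= p)%N.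
  rewrite upper; apply: min_i => free_q; apply: (sequence_not_free prime_t (k := l)).
  exact: free_of_divisor q0 Ilq free_q.
have le_pl : (p <= l)%N.
  rewrite leqNgt; apply/negP=> /(sequence_free prime_t); rewrite tp => free_l.
  exact/dep_i/(free_of_divisor (sequence_neq0 prime_t l) Iql free_l).
have le_ik : (i <= k)%N.
  rewrite leqNgt; apply/negP=> /(sequence_free prime1).
  by rewrite perm1; apply: dep_i.
have normal_q a : principal_ideal setT q (br q a).
  apply: normal_generated => // j; have [le_ij|lt_ji] := leqP i j.
    apply: normal_assoc Ilq Iql _ => //; apply: (sequence_normal prime_t).
    rewrite -(permKV t j); apply: gen_sub_var.
    by rewrite /= ltnS (leq_trans _ le_pl) // upper permKV.
  apply: (sequence_normal prime1); rewrite -(perm1 j); apply: gen_sub_var.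
  by rewrite /= ltnS (leq_trans (ltnW lt_ji)).
have poisson_q : poisson_prime br (initial_sub 1%g N) q.
  by rewrite initial_sub_full //; have [_ _ q1 qM] := sequence_prime prime1 k; split.
have homogeneous_q : homogeneous act q by case: prime1 => _ homy _; apply: homy.
have le_1NN : (1 <= N <= N)%N by rewrite N_gt0 leqnn.
have [_ _ /(_ N le_1NN) /= [_ last1]] := prime1.
case/(_ q homogeneous_q poisson_q): last1 => j [[_ last_j] [c c0 def_q]].
have Ijk : principal_ideal setT (y 1%g j) (y 1%g k).
  by exists c%:MP; rewrite // /= mul_mpolyC.
have def_k := sequence_assoc_inj prime1 Ijk; rewrite def_k in last_j.
case def_l: (level_succ (eta 1%g) k) succ_k => [m|] // _.
by have := last_j _ def_l; rewrite leqNgt ltn_ord.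
Qed.

(** The denominators allowed for t, and those contributed by inv: in the language
    of cluster algebras, y_(t,k) is mutable if its successor is finite and
    frozen otherwise. *)
Definition mutable_monomials t : set R :=
  mult_gen ([set c%:MP | c in [set c : K | c != 0]]
            `|` [set y t k | k in [set k | level_succ (eta t) k <> None]]).

Definition frozen_monomials (inv : {set 'I_N}) : set R :=
  mult_gen [set y 1%g k | k in [set k | k \in inv]].

Lemma mult_gen_neq0 (S : set R) : (forall b, S b -> b != 0) ->
  forall e, mult_gen S e -> e != 0.
Proof.
move=> S0 e; elim=> {e} [|b /S0//|a b _ a0 _ b0]; first exact: oner_neq0.
by rewrite mulf_neq0.
Qed.

Lemma prime_elt_mult_gen (S : set R) q : prime_elt setT q ->
  (forall b, S b -> ~ principal_ideal setT q b) ->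
  forall e, mult_gen S e -> ~ principal_ideal setT q e.
Proof.
move=> [_ _ q1 qM] Sq e; elim=> {e} [//|b /Sq//|a b _ Na _ Nb].
by case/qM.
Qed.

Lemma prime_ndvd_const (q : R) (c : K) : prime_elt setT q -> c != 0 ->
  ~ principal_ideal setT q c%:MP.
Proof.
move=> [_ _ q1 _] c0 [b _ /= def_c]; apply: q1; exists (c^-1%:MP * b) => //=.
by rewrite -mulrA def_c -mpolyCM mulVf.
Qed.

Lemma mutable_monomial_neq0 t e : Xi t -> mutable_monomials t e -> e != 0.
Proof.
move=> /y_prime prime_t; apply: mult_gen_neq0 => _ [[c c0 <-]|[k _ <-]].
  by rewrite mpolyC_eq0.
exact: sequence_neq0 prime_t k.
Qed.

Variable inv : {set 'I_N}.
Hypothesis inv_last : forall k, k \in inv -> level_succ (eta 1%g) k = None.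

(** By induction on the factors of e: a prime factor q of e avoids all primes of
    some t in Gamma, and it is associated to no y_k with k in inv, so it divides a
    and can be cancelled. The permutation t depends on q, which is why the
    hypothesis quantifies over all of Gamma. *)
Lemma mutable_monomial_cancel e a : mutable_monomials 1%g e ->
  (forall t, Gamma t -> exists d m, [/\ mutable_monomials t d, frozen_monomials inv m
     & principal_ideal setT e (a * (d * m))]) ->
  principal_ideal setT e a.
Proof.
move=> Ee; elim: Ee a => {e} [|_ [[c c0 <-]|[k succ_k <-]]|e1 e2 Ee1 IH1 _ IH2] a Ia.
- by exists a; rewrite ?mulr1.
- exists (a * c^-1%:MP) => //=; rewrite -mulrA -mpolyCM mulVf ?mulr1 //.
- have [t Gt avoid] := mutable_prime_avoided succ_k.
  have prime1 := y_prime (Gamma_Xi (Gamma_id N_gt0)).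
  have prime_q := sequence_prime prime1 k.
  have [_ _ _ qM] := prime_q; have [d [m [Ed Mm]]] := Ia t Gt.
  case/qM => // /qM[] // Iq; exfalso; move: Iq.
    apply: prime_elt_mult_gen Ed => // _ [[c c0 <-]|[l _ <-]]; last exact: avoid.
    exact: prime_ndvd_const.
  apply: prime_elt_mult_gen Mm => // _ [l inv_l <-].
  by move/(sequence_assoc_inj prime1) => def_k; apply: succ_k; rewrite def_k inv_last.
(* Cancel e1 from a first, then e2 from the quotient. *)
have [|b _ /= def_a] := IH1 a.
  move=> t /Ia[d [m [Ed Mm [b _ /= def_a]]]]; exists d, m; split=> //.
  by exists (b * e2) => //=; rewrite -def_a -mulrA [e2 * e1]mulrC.
have e1_neq0 : e1 != 0.
  by apply: mutable_monomial_neq0 Ee1; apply/Gamma_Xi/Gamma_id.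
have [|c _ /= def_b] := IH2 b.
  move=> t /Ia[d [m [Ed Mm [c _ /= def_c]]]]; exists d, m; split=> //.
  exists c => //=; apply: (mulIf e1_neq0).
  by rewrite -mulrA [e2 * e1]mulrC def_c -def_a mulrAC.
by exists c => //=; rewrite -def_a -def_b mulrAC -mulrA.
Qed.

End Families.

(** * Localizations inside the field of fractions *)
Section Clusters.
Variables (K : fieldType) (N r : nat) (br : {mpoly K[N]} -> {mpoly K[N]} -> {mpoly K[N]})
  (act : 'rV[K]_r -> {mpoly K[N]} -> {mpoly K[N]}) (eta : {perm 'I_N} -> 'I_N -> int)
  (y : {perm 'I_N} -> 'I_N -> {mpoly K[N]}).
Hypothesis N_gt0 : (0 < N)%N.
Hypothesis br_poisson : poisson_bracket br.
Hypothesis y_prime : forall t, Xi t -> prime_sequence br act t (eta t) (y t).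
Notation R := {mpoly K[N]}.
Notation F := {fraction {mpoly K[N]}}.
Implicit Types (k l : 'I_N) (t : {perm 'I_N}) (a b d e m : R).

Notation mutable := (mutable_monomials eta y).
Notation frozen := (frozen_monomials y).
Notation cluster t := (subalg_gen (@mpolyC N K) (range (y t))).

Lemma mutable_cluster t e : mutable t e -> cluster t e.
Proof.
elim=> {e} [|_ [[c _ <-]|[k _ <-]]|a b _ Ca _ Cb].
- by rewrite -mpolyC1; apply: subalg_const.
- exact: subalg_const.
- by apply: subalg_mem; exists k.
- exact: subalg_mul.
Qed.

(** The polynomials with this property form a subalgebra. It contains x_k by
    induction on k, because x_k * y_(p(k)) = y_k + c_k with c_k a polynomial in
    the earlier variables. *)
Lemma cluster_denominator t a : Xi t ->
  exists2 e, mutable t e & cluster t (a * e).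
Proof.
move=> /y_prime prime_t.
pose L b := exists2 e, mutable t e & cluster t (b * e).
have L_gen (P : pred 'I_N) b : (forall i, P i -> L 'X_(t i)) -> gen_sub t P b -> L b.
  move=> LX; elim=> {b} [c|_ [i Pi <-]|b c _ [e1 E1 C1] _ [e2 E2 C2]
                         |b c _ [e1 E1 C1] _ [e2 E2 C2]].
  - exists 1; [exact: mult_one | rewrite mulr1; exact: subalg_const].
  - exact: LX.
  - exists (e1 * e2); first exact: mult_mul.
    rewrite mulrDl mulrA [c * _]mulrCA; apply: subalg_add; apply: subalg_mul => //.
      exact: mutable_cluster.
    exact: mutable_cluster.
  - exists (e1 * e2); first exact: mult_mul.
    by rewrite mulrACA; apply: subalg_mul.
(* The bound n makes the induction on k a strong one. *)
have LX (n : nat) k : (k < n)%N -> L 'X_(t k).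
  elim: n k => // n IHn k lt_kn; case: prime_t => /(_ k) + _ _.
  have Cy l : cluster t (y t l) by apply: subalg_mem; exists l.
  case def_j: (level_pred (eta t) k) => [j|] => [[c [Sc _ def_y]]|def_y].
    have [|e Ee Ce] := @L_gen (fun i => (i < k)%N) c _ Sc.
      by move=> i lt_ik; apply: IHn; apply: leq_trans lt_ik _.
    exists (y t j * e).
      apply: mult_mul => //; apply: mult_mem; right; exists j => //=.
      by rewrite (level_pred_succ def_j).
    have -> : 'X_(t k) * (y t j * e) = y t k * e + c * e.
      by rewrite -mulrDl def_y subrK mulrA [_ * y t j]mulrC.
    apply: subalg_add => //; apply: subalg_mul => //; exact: mutable_cluster.
  by exists 1; [exact: mult_one | rewrite mulr1 -def_y].
apply: (@L_gen xpredT); first by move=> i _; apply: (LX N).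
have : initial_sub t N a by rewrite initial_sub_full.
exact: gen_sub_le.
Qed.

HB.instance Definition _ := GRing.RMorphism.on (@to_fract K N).

Lemma to_fract_eq0 a : (to_fract a == 0) = (a == 0).
Proof. exact: tofrac_eq0. Qed.

Lemma to_fract_inj : injective (@to_fract K N).
Proof. by move=> a b /eqP; rewrite /to_fract tofrac_eq => /eqP. Qed.

Lemma to_fract_divP a b d e : d != 0 -> e != 0 ->
  to_fract a / to_fract d = to_fract b / to_fract e -> a * e = b * d.
Proof.
move=> d0 e0 /eqP; rewrite eqr_div ?to_fract_eq0 // -!rmorphM.
by move/eqP/to_fract_inj.
Qed.

Lemma poly_ring_localize t : Xi t ->
  poly_ring K N `<=` localize (cluster_alg (y t)) (cluster_denom (eta t) (y t)).
Proof.
move=> Xt _ [a _ <-]; have [e Ee Ce] := cluster_denominator a Xt.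
exists (to_fract (a * e)); first by exists (a * e).
exists (to_fract e); first by exists e.
have e0 := mutable_monomial_neq0 y_prime Xt Ee.
by rewrite rmorphM mulfK // to_fract_eq0.
Qed.

Lemma localize_poly_ring t : Xi t ->
  localize (poly_ring K N) (cluster_denom (eta t) (y t))
  = localize (cluster_alg (y t)) (cluster_denom (eta t) (y t)).
Proof.
move=> Xt; apply/seteqP; split=> [_ [a Ra [_ [e Ee <-] <-]]|_ [_ [a _ <-] [e Ee <-]]]; last first.
  by exists (to_fract a); [exists a | exists e].
have [b Cb [_ [d Ed <-] <-]] := poly_ring_localize Xt Ra.
exists b => //; exists (to_fract (d * e)).
  by exists (d * e) => //; apply: mult_mul.
by rewrite rmorphM invfM mulrA.
Qed.

Lemma localize_cluster_torus t :
  localize (cluster_alg (y t)) (cluster_denom (eta t) (y t)) `<=` cluster_torus (y t).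
Proof.
move=> _ [_ [a Ca <-] [_ [e Ee <-] <-]]; apply: subalg_mul.
  elim: Ca => {a} [c|_ [k _ <-]|a b _ Ta _ Tb|a b _ Ta _ Tb].
  - exact: (subalg_const (fun c : K => to_fract c%:MP)).
  - by apply: subalg_mem; left; exists k.
  - by rewrite rmorphD; apply: subalg_add.
  - by rewrite rmorphM; apply: subalg_mul.
elim: Ee => {a Ca e} [|_ [[c c0 <-]|[k _ <-]]|a b _ Ta _ Tb].
- rewrite rmorph1 invr1 -(rmorph1 (@to_fract K N)) -mpolyC1.
  exact: (subalg_const (fun c : K => to_fract c%:MP)).
- have -> : (to_fract c%:MP)^-1 = to_fract (c^-1)%:MP :> F.
    apply: (mulfI (x := to_fract c%:MP)); first by rewrite to_fract_eq0 mpolyC_eq0.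
    rewrite mulfV ?to_fract_eq0 ?mpolyC_eq0 //.
    by rewrite -rmorphM -mpolyCM mulfV // mpolyC1 rmorph1.
  exact: (subalg_const (fun c : K => to_fract c%:MP)).
- by apply: subalg_mem; right; exists k.
- by rewrite rmorphM invfM; apply: subalg_mul.
Qed.

Variable inv : {set 'I_N}.
Hypothesis inv_last : forall k, k \in inv -> level_succ (eta 1%g) k = None.

Lemma frozen_neq0 m : frozen inv m -> m != 0.
Proof.
apply: mult_gen_neq0 => _ [k _ <-].
by apply: sequence_neq0; apply/y_prime/Gamma_Xi/Gamma_id.
Qed.

(** Write f = a / (d m) for the original presentation. Comparing with the
    expressions of f for the other t shows that d divides a up to factors
    allowed for t, which [mutable_monomial_cancel] turns into d dividing a. *)
Lemma mixed_denominator_cancel (f : F) :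
  (forall t, Gamma t -> exists a d m,
     [/\ mutable t d, frozen inv m & f = to_fract a / to_fract (d * m)]) ->
  exists b m, frozen inv m /\ f = to_fract b / to_fract m.
Proof.
move=> f_frac; have G1 := Gamma_id N_gt0.
have dm0 t d m : Gamma t -> mutable t d -> frozen inv m -> d * m != 0.
  move=> Gt Ed Mm; apply: mulf_neq0; last exact: frozen_neq0.
  exact (mutable_monomial_neq0 y_prime (Gamma_Xi Gt) Ed).
have [a [d [m [Ed Mm def_f]]]] := f_frac _ G1.
have [b _ /= def_a] : principal_ideal setT d a.
  apply: (mutable_monomial_cancel N_gt0 br_poisson y_prime inv_last Ed) => t Gt.
  have [b [e [n [Ee Mn def_f']]]] := f_frac _ Gt; exists e, n; split=> //.
  exists (b * m) => //=; rewrite -mulrA [m * d]mulrC; symmetry.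
  by apply: (to_fract_divP (dm0 _ _ _ G1 Ed Mm) (dm0 _ _ _ Gt Ee Mn)); rewrite -def_f.
exists b, m; split=> //; rewrite def_f -def_a [b * d]mulrC.
have d0 := mutable_monomial_neq0 y_prime (Gamma_Xi G1) Ed.
by rewrite !rmorphM -mulf_div mulfV ?mul1r ?to_fract_eq0.
Qed.

Lemma adjoin_inv_mixed t (f : F) : Gamma t ->
  adjoin_inv (localize (poly_ring K N) (cluster_denom (eta t) (y t)))
    [set to_fract (y 1%g k) | k in [set k | k \in inv]] f ->
  exists a d m, [/\ mutable t d, frozen inv m & f = to_fract a / to_fract (d * m)].
Proof.
move=> Gt.
have dm0 d m : mutable t d -> frozen inv m -> to_fract (d * m) != 0.
  move=> Ed Mm; rewrite to_fract_eq0; apply: mulf_neq0; last exact: frozen_neq0.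
  exact (mutable_monomial_neq0 y_prime (Gamma_Xi Gt) Ed).
elim=> {f} [c|f [[_ [a _ <-] [_ [e Ee <-] <-]]|[_ [k inv_k <-] <-]]
           |_ _ _ [a [d [m [Ed Mm ->]]]] _ [b [e [n [Ee Mn ->]]]]
           |_ _ _ [a [d [m [Ed Mm ->]]]] _ [b [e [n [Ee Mn ->]]]]].
- exists c%:MP, 1, 1; split; [exact: mult_one | exact: mult_one |].
  by rewrite mulr1 rmorph1 divr1.
- exists a, e, 1; split=> //; first exact: mult_one.
  by rewrite mulr1.
- exists 1, 1, (y 1%g k); split; first exact: mult_one.
    by apply: mult_mem; exists k.
  by rewrite mul1r rmorph1 mul1r.
- exists (a * (e * n) + b * (d * m)), (d * e), (m * n).
  split; [exact: mult_mul | exact: mult_mul |].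
  by rewrite addf_div ?dm0 // mulrACA -!rmorphM -rmorphD.
- exists (a * b), (d * e), (m * n); split; [exact: mult_mul | exact: mult_mul |].
  by rewrite mulf_div mulrACA -!rmorphM.
Qed.

Lemma adjoin_inv_frozen a m : frozen inv m ->
  adjoin_inv (poly_ring K N) [set to_fract (y 1%g k) | k in [set k | k \in inv]]
    (to_fract a / to_fract m).
Proof.
move=> Mm; apply: subalg_mul; first by apply: subalg_mem; left; exists a.
elim: Mm => {m} [|_ [k inv_k <-]|m n _ Im _ In].
- by rewrite rmorph1 invr1; apply: subalg_mem; left; exists 1; rewrite ?rmorph1.
- apply: subalg_mem; right; exists (to_fract (y 1%g k)) => //.
  by exists k.
- by rewrite rmorphM invfM; apply: subalg_mul.
Qed.

Lemma poly_ring_sub_localize t :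
  poly_ring K N `<=` localize (poly_ring K N) (cluster_denom (eta t) (y t)).
Proof.
move=> f Rf; exists f => //; exists 1; last by rewrite divr1.
by exists 1; [exact: mult_one | exact: tofrac1].
Qed.

Lemma adjoin_inv_le (A B Y : set F) : A `<=` B -> adjoin_inv A Y `<=` adjoin_inv B Y.
Proof.
move=> sAB f; elim=> {f} [c|f [Af|Yf]|f g _ Bf _ Bg|f g _ Bf _ Bg].
- exact: subalg_const.
- by apply: subalg_mem; left; apply: sAB.
- by apply: subalg_mem; right.
- exact: subalg_add.
- exact: subalg_mul.
Qed.

Lemma adjoin_inv_bigcap :
  let Y := [set to_fract (y 1%g k) | k in [set k | k \in inv]] in
  adjoin_inv (poly_ring K N) Y =
  \bigcap_(t in @Gamma N)
     adjoin_inv (localize (poly_ring K N) (cluster_denom (eta t) (y t))) Y.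
Proof.
apply/seteqP; split=> f If.
  by move=> t _; apply: adjoin_inv_le If; apply: poly_ring_sub_localize.
have [t /[dup] Gt /If/adjoin_inv_mixed|b [m [Mm ->]]] := @mixed_denominator_cancel f.
  exact.
exact: adjoin_inv_frozen.
Qed.

End Clusters.

Theorem theorem10p5 (K : fieldType) (charK : [pchar K] =i pred0)
    (N r : nat) (N_gt0 : (0 < N)%N)
    (br : {mpoly K[N]} -> {mpoly K[N]} -> {mpoly K[N]})
    (act lie : 'rV[K]_r -> {mpoly K[N]} -> {mpoly K[N]})
    (sigma delta : 'I_N -> {mpoly K[N]} -> {mpoly K[N]})
    (R_PCGL : is_PCGL br act lie sigma delta)
    (R_symm : symmetric_PCGL lie sigma delta)
    (eta : {perm 'I_N} -> 'I_N -> int)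
    (y : {perm 'I_N} -> 'I_N -> {mpoly K[N]})
    (y_prime : forall t, Xi t -> prime_sequence br act t (eta t) (y t)) :
  let R := poly_ring K N in
  let A t := cluster_alg (y t) in
  let T t := cluster_torus (y t) in
  let E t := cluster_denom (eta t) (y t) in
  [/\ (* (a) *)
      forall t, Xi t ->
        [/\ A t `<=` R, R `<=` localize (A t) (E t),
            localize (A t) (E t) `<=` T t & T t `<=` setT],
      (* (b) *)
      subalg_gen (@mpolyC N K) [set f | exists2 t, Gamma t & exists k, f = y t k]
        = setT,
      (* (c) *)
      forall t, Xi t -> localize R (E t) = localize (A t) (E t),
      (* (d) *)
      R = \bigcap_(t in @Gamma N) localize R (E t) /\
      \bigcap_(t in @Gamma N) localize R (E t)
        = \bigcap_(t in @Gamma N) localize (A t) (E t)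
    & (* (e) *)
      forall inv : {set 'I_N},
        (forall k, k \in inv -> level_succ (eta 1%g) k = None) ->
        let Y := [set to_fract (y 1%g k) | k in [set k | k \in inv]] in
        adjoin_inv R Y = \bigcap_(t in @Gamma N) adjoin_inv (localize R (E t)) Y].
Proof.
move=> R A T E; have br_poisson := PCGL_bracket R_PCGL; split.
- move=> t Xt; split.
  + by move=> _ [a _ <-]; exists a.
  + exact: (poly_ring_localize y_prime Xt).
  + exact: localize_cluster_torus.
  + exact: subsetT.
- apply/seteqP; split=> // a _.
  have : initial_sub 1%g N a by rewrite initial_sub_full.
  elim=> {a} [c|_ [j _ <-]|a b _ Ia _ Ib|a b _ Ia _ Ib].
  + exact: subalg_const.
  + rewrite perm1; have [t [Gt [k [k0 <-]]]] := Gamma_first j.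
    apply: subalg_mem; exists t => //; exists k.
    case: (y_prime t (Gamma_Xi Gt)) => /(_ k) + _ _.
    by case def_p: (level_pred (eta t) k) => [p|] //; have := level_pred_lt def_p; rewrite k0.
  + exact: subalg_add.
  + exact: subalg_mul.
- by move=> t Xt; exact: (localize_poly_ring y_prime Xt).
- split; last first.
    by apply: eq_bigcapr => t Gt; exact: (localize_poly_ring y_prime (Gamma_Xi Gt)).
  apply/seteqP; split=> f If; first by move=> t _; apply: poly_ring_sub_localize.
  have no_inv k : k \in (finset.set0 : {set 'I_N}) -> level_succ (eta 1%g) k = None.
    by rewrite finset.in_set0.
  have [t Gt|b [m [Mm ->]]] := mixed_denominator_cancel N_gt0 br_poisson y_prime no_inv (f := f).
    have [_ [a _ <-] [_ [d Ed <-] <-]] := If t Gt; exists a, d, 1.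
    by split; [| exact: mult_one | rewrite mulr1].
  (* With no inverted y_k, the only frozen denominator is 1. *)
  have -> : m = 1.
    elim: Mm => {m} [//|b0 [k /= inv_k _]|m n _ -> _ ->]; last by rewrite mulr1.
    by rewrite finset.in_set0 in inv_k.
  by exists b; rewrite // rmorph1 divr1.
- by move=> inv inv_last; exact: (adjoin_inv_bigcap N_gt0 br_poisson y_prime inv_last).
Qed.
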